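(* In the setting and under the regularity assumption of the context, fix $x\in\mathcal X$ (write $\ell_k(z)=\ell_k(x,z)$), $i\in[N]$, $1\le k_1<k_2\le K$ and $b\in\mathbb R_+$. For $\alpha\in A:=\{(\alpha_1,\alpha_2):\alpha_1+\alpha_2=1,\ \alpha_1,\alpha_2>0\}$ and $\beta\in B:=\{(\beta_1,\beta_2):\beta_1+\beta_2=b,\ \beta_1,\beta_2\ge0\}$ let $$\Psi_i^{(k_1,k_2)}(\alpha,\beta)=\max_{v_1,v_2}\Big\{\alpha_1\ell_{k_1}(\hat z_i+v_1)+\alpha_2\ell_{k_2}(\hat z_i+v_2): v_j\in\mathbb R^m,\ \hat z_i+v_j\in\mathcal Z,\ \alpha_jc(\hat z_i+v_j,\hat z_i)\le\beta_j,\ j\in\{1,2\}\Big\}.$$ Then: (i) for each fixed $\alpha\in A$, $\Psi_i^{(k_1,k_2)}(\alpha,\cdot)$ is concave in $\beta\in B$; (ii) the partial maximum $\Phi_i^{(k_1,k_2)}(\alpha):=\max_{\beta\in B}\Psi_i^{(k_1,k_2)}(\alpha,\beta)$ is concave in $\alpha\in A$.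
   Context: Notation: $[n]=\{1,\dots,n\}$; $\mathcal P(\mathcal Z)$ is the set of Borel probability measures on $\mathcal Z$. Setting. $\mathcal X\subseteq\mathbb R^n$, $\mathcal Z\subseteq\mathbb R^m$. A transportation cost $c:\mathcal Z\times\mathcal Z\to\mathbb R_+$ is lower semicontinuous, satisfies $c(z,z)=0$ for all $z$, and $c(\cdot,\hat z)$ is convex for every fixed $\hat z\in\mathcal Z$. The optimal transport discrepancy is $\mathrm{OT}_c(\mathbb P,\mathbb Q)=\min_{\gamma}\mathbb E_{(z,\hat z)\sim\gamma}[c(z,\hat z)]$ over couplings $\gamma$ of $\mathbb P$ and $\mathbb Q$. Given $\hat z_1,\dots,\hat z_N\in\mathcal Z$, let $\hat{\mathbb P}=\frac1N\sum_{i=1}^N\delta_{\hat z_i}$; given $\rho>0$, let $\mathcal P=\{\mathbb P\in\mathcal P(\mathcal Z):\mathrm{OT}_c(\mathbb P,\hat{\mathbb P})\le\rho\}$. Regularity assumption. (i) $\mathcal X$ is nonempty and convex; there exist $\mathbb Q_0\in\mathcal P$ and $x_0\in\mathcal X$ such that $x\mapsto\mathbb E_{z\sim\mathbb Q_0}[\ell(x,z)]$ is inf-compact on $\mathcal X$ (all sublevel sets are compact) and $\mathbb E_{z\sim\mathbb Q_0}[\ell(x_0,z)]>-\infty$; $\mathcal Z$ is nonempty, closed and convex. (ii) $\ell(x,z)=\max_{k\in[K]}\ell_k(x,z)$ with $K\ge2$, where each $\ell_k:\mathbb R^n\times\mathbb R^m\to\mathbb R$ is real-valued, convex in its first and concave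 in its second argument. (iii) There exist a norm $\|\cdot\|$ on $\mathbb R^m$ and $p\ge1$ with $c(z,\hat z)\ge\|z-\hat z\|^p$ for all $z,\hat z\in\mathcal Z$; moreover, if $p=1$, then for every $x\in\mathcal X$ there exist $g>0$, $\hat z_0\in\mathcal Z$ and $r\in[0,1)$ such that $\ell(x,z)\le g[1+\|z-\hat z_0\|^r]$ for all $z\in\mathcal Z$. *)

(* Defs.v *)
From HB Require Import structures.
From mathcomp Require Import all_boot all_order all_algebra.
From mathcomp Require Import all_classical all_reals all_analysis.

Set Implicit Arguments.
Unset Strict Implicit.
Unset Printing Implicit Defensive.

Import Order.TTheory GRing.Theory Num.Theory.
Import numFieldNormedType.Exports.

Local Open Scope classical_set_scope.
Local Open Scope ring_scope.
Local Open Scope convex_scope.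

Notation borel_rV R m := (g_sigma_algebraType (@open 'rV[R]_m)).

Definition concave_function (R : numFieldType) (E : lmodType R)
    (E' := convex_lmodType E) (D : set E') (f : E' -> R^o) : Prop :=
  forall t : {i01 R},
    {in D &, forall x y : E', f x <| t |> f y <= f (x <| t |> y)}.

Definition is_maximum (R : realType) (S : set R) (y : R) : Prop :=
  S y /\ ubound S y.

Record is_norm (R : realType) (m : nat) (nrm : 'rV[R]_m -> R) : Prop := {
  is_normD : forall u v, nrm (u + v) <= nrm u + nrm v;
  is_normZ : forall a v, nrm (a *: v) = `|a| * nrm v;
  is_norm0_eq0 : forall v, nrm v = 0 -> v = 0 }.

(* The function [c] is total; only its values on [Z `*` Z] are constrained
   or used.  Semicontinuity is relative to [Z `*` Z]: the topology of
   [subspace A] is the trace topology at the points of [A] and is discrete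
   elsewhere. *)
Record transportation_cost (R : realType) (m : nat) (Z : set 'rV[R]_m)
    (c : 'rV[R]_m -> 'rV[R]_m -> R) : Prop := {
  cost_ge0 : forall z zh, Z z -> Z zh -> 0 <= c z zh;
  cost_lsc : lower_semicontinuous
    (fun w : subspace (Z `*` Z) => (c w.1 w.2)%:E);
  cost_refl : forall z, Z z -> c z z = 0;
  cost_convex : forall zh, Z zh -> convex_function Z (c ^~ zh) }.

Definition coupling (R : realType) (m : nat)
    (P Q : {measure set (borel_rV R m) -> \bar R}) :
    set (probability (borel_rV R m * borel_rV R m)%type R) :=
  [set g | forall B, measurable B ->
     pushforward g fst B = P B /\ pushforward g snd B = Q B].

(* [P] and [Q] are meant to be concentrated on [Z], so that every coupling
   is concentrated on [Z `*` Z]. *)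
Definition OT (R : realType) (m : nat) (Z : set 'rV[R]_m)
    (c : 'rV[R]_m -> 'rV[R]_m -> R)
    (P Q : {measure set (borel_rV R m) -> \bar R}) : \bar R :=
  ereal_inf [set (\int[g]_(w in Z `*` Z) (c w.1 w.2)%:E)%E
            | g in coupling P Q].

Definition empirical (R : realType) (m N : nat) (zhat : 'I_N -> borel_rV R m)
    (B : set (borel_rV R m)) : \bar R :=
  ((N%:R^-1)%:E * \sum_(i < N) \d_(zhat i) B)%E.

Section empirical_measure.
Context (R : realType) (m N : nat) (zhat : 'I_N -> borel_rV R m).
Local Open Scope ereal_scope.

Let empirical0 : empirical zhat set0 = 0.
Proof. by rewrite /empirical big1 ?mule0// => i _; rewrite measure0. Qed.

Let empirical_ge0 B : 0 <= empirical zhat B.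
Proof.
by rewrite /empirical mule_ge0 ?lee_fin ?invr_ge0 ?ler0n// sume_ge0.
Qed.

Let empirical_sigma_additive : semi_sigma_additive (empirical zhat).
Proof.
move=> F mF tF mUF; rewrite /empirical.
under eq_fun.
  move=> n; rewrite -ge0_sume_distrr; last by move=> ? _; exact: sume_ge0.
  rewrite exchange_big/=; over.
apply: cvgeZl => //; apply: cvg_nnesum.
  by move=> i _; near do exact: sume_ge0.
by move=> i _; exact: measure_semi_sigma_additive.
Unshelve. all: by end_near. Qed.

HB.instance Definition _ := isMeasure.Build _ _ _ (empirical zhat)
  empirical0 empirical_ge0 empirical_sigma_additive.

End empirical_measure.

Definition ambiguity_set (R : realType) (m N : nat) (Z : set 'rV[R]_m)
    (c : 'rV[R]_m -> 'rV[R]_m -> R) (zhat : 'I_N -> 'rV[R]_m) (rho : R) :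
    set (probability (borel_rV R m) R) :=
  [set P : probability (borel_rV R m) R | P Z = 1%E /\ (OT Z c P (empirical zhat) <= rho%:E)%E].

(* [-oo] is the neutral element of [maxe]; the maximum is finite when
   [0 < K]. *)
Definition loss (R : realType) (n m K : nat)
    (l : 'I_K -> 'rV[R]_n -> 'rV[R]_m -> R)
    (x : 'rV[R]_n) (z : 'rV[R]_m) : \bar R :=
  \big[maxe/-oo%E]_(k < K) (l k x z)%:E.

(* For [P] in the ambiguity set, the positive part of the loss is integrable
   (the pieces are majorized by affine functions of [z] and the cost grows at
   least like the [p]-th power of a norm, [1 <= p]), so no [+oo - oo] occurs
   in this integral. *)
Definition expected_loss (R : realType) (n m K : nat) (Z : set 'rV[R]_m)
    (l : 'I_K -> 'rV[R]_n -> 'rV[R]_m -> R)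
    (P : probability (borel_rV R m) R) (x : 'rV[R]_n) : \bar R :=
  (\int[P]_(z in Z) loss l x z)%E.

Definition inf_compact (R : realType) (n : nat) (X : set 'rV[R]_n)
    (f : 'rV[R]_n -> \bar R) : Prop :=
  forall t : R, compact [set x | X x /\ (f x <= t%:E)%E].

Record regularity (R : realType) (n m N K : nat)
    (X : set 'rV[R]_n) (Z : set 'rV[R]_m)
    (c : 'rV[R]_m -> 'rV[R]_m -> R) (zhat : 'I_N -> 'rV[R]_m) (rho : R)
    (l : 'I_K -> 'rV[R]_n -> 'rV[R]_m -> R) : Prop := {
  reg_X_neq0 : X !=set0;
  reg_X_convex : convex_set X;
  reg_inf_compact : exists2 Q0, ambiguity_set Z c zhat rho Q0 &
    exists2 x0, X x0 &
      inf_compact X (expected_loss Z l Q0) /\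
      (-oo < expected_loss Z l Q0 x0)%E;
  reg_Z_neq0 : Z !=set0;
  reg_Z_closed : closed Z;
  reg_Z_convex : convex_set Z;
  reg_K_ge2 : (2 <= K)%N;
  reg_loss_convex : forall k z, convex_function setT (fun x => l k x z);
  reg_loss_concave : forall k x, concave_function setT (l k x);
  reg_growth : exists (nrm : 'rV[R]_m -> R) (p : R),
    [/\ is_norm nrm, 1 <= p,
        forall z zh, Z z -> Z zh -> nrm (z - zh) `^ p <= c z zh &
        p = 1 -> forall x, X x -> exists (g : R) (zh0 : 'rV[R]_m) (r : R),
          [/\ 0 < g, Z zh0, 0 <= r < 1 &
              forall z, Z z ->
                (loss l x z <= (g * (1 + nrm (z - zh0) `^ r))%:E)%E]] }.

Definition weights (R : realType) : set (R^o * R^o) :=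
  [set a | [/\ a.1 + a.2 = 1, 0 < a.1 & 0 < a.2]].

Definition budgets (R : realType) (b : R) : set (R^o * R^o) :=
  [set be | [/\ be.1 + be.2 = b, 0 <= be.1 & 0 <= be.2]].

Definition Psi_values (R : realType) (m : nat) (Z : set 'rV[R]_m)
    (c : 'rV[R]_m -> 'rV[R]_m -> R) (zh : 'rV[R]_m)
    (l1 l2 : 'rV[R]_m -> R) (a be : R^o * R^o) : set R :=
  [set a.1 * l1 (zh + v.1) + a.2 * l2 (zh + v.2) | v in
    [set v : 'rV[R]_m * 'rV[R]_m |
      [/\ Z (zh + v.1), Z (zh + v.2),
          a.1 * c (zh + v.1) zh <= be.1 & a.2 * c (zh + v.2) zh <= be.2]]].

(* [sup] returns the default value 0 on a set with no supremum; that [Psi] and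
   [Phi] are genuine maxima is the content of [is_maximum] for their sets of
   values. *)
Definition Psi (R : realType) (m : nat) (Z : set 'rV[R]_m)
    (c : 'rV[R]_m -> 'rV[R]_m -> R) (zh : 'rV[R]_m)
    (l1 l2 : 'rV[R]_m -> R) (a be : R^o * R^o) : R :=
  sup (Psi_values Z c zh l1 l2 a be).

Definition Phi_values (R : realType) (m : nat) (Z : set 'rV[R]_m)
    (c : 'rV[R]_m -> 'rV[R]_m -> R) (zh : 'rV[R]_m)
    (l1 l2 : 'rV[R]_m -> R) (b : R) (a : R^o * R^o) : set R :=
  [set Psi Z c zh l1 l2 a be | be in budgets b].

Definition Phi (R : realType) (m : nat) (Z : set 'rV[R]_m)
    (c : 'rV[R]_m -> 'rV[R]_m -> R) (zh : 'rV[R]_m)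
    (l1 l2 : 'rV[R]_m -> R) (b : R) (a : R^o * R^o) : R :=
  sup (Phi_values Z c zh l1 l2 b a).

(* Main.v *)
(* Writing [z_j = zh + v_j], the maximum over [be] of [Psi] is the maximum of
   [a_1 l_1(z_1) + a_2 l_2(z_2)] under the single constraint
   [a_1 c(z_1, zh) + a_2 c(z_2, zh) <= b].  Maxima are attained because a finite
   concave function on R^m is continuous and because the sublevel sets of
   [c(., zh)] in [Z] are compact: they are closed by semicontinuity and bounded
   since [c] dominates [nrm(z - zh)^p].  For concavity, optimal points [z], [z']
   at [a], [a'] are averaged with weights proportional to [s a_j] and [u a'_j];
   the products [a_j l_j(z_j)] and [a_j c(z_j, zh)] are perspectives, so this
   average is feasible and at least as good as the average of the values. *)
Require Import Defs.
From mathcomp Require Import all_boot all_order all_algebra.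
From mathcomp Require Import all_classical all_reals all_analysis.
From mathcomp Require Import ring lra.
Import Order.TTheory GRing.Theory Num.Theory.
Import numFieldNormedType.Exports.
Local Open Scope classical_set_scope.
Local Open Scope ring_scope.

Lemma concave_functionP {R : realType} {E : lmodType R} (D : set E)
    (f : E -> R) :
  concave_function D f <->
  forall x y s u, D x -> D y -> 0 <= s -> 0 <= u -> s + u = 1 ->
    s * f x + u * f y <= f (s *: x + u *: y).
Proof.
split=> [cf x y s u Dx Dy s0 u0 su1|cf t x y /set_mem Dx /set_mem Dy].
  have s1 : s <= 1 by rewrite -su1 lerDl.
  have -> : u = 1 - s by rewrite -su1 addrAC subrr add0r.
  exact: cf (Itv01 s0 s1) x y (mem_set Dx) (mem_set Dy).
by apply: cf => //; [rewrite subr_ge0|rewrite subrKC].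
Qed.

Lemma convex_functionP {R : realType} {E : lmodType R} (D : set E)
    (f : E -> R) :
  convex_function D f <->
  forall x y s u, D x -> D y -> 0 <= s -> 0 <= u -> s + u = 1 ->
    f (s *: x + u *: y) <= s * f x + u * f y.
Proof.
split=> [cf x y s u Dx Dy s0 u0 su1|cf t x y /set_mem Dx /set_mem Dy].
  have s1 : s <= 1 by rewrite -su1 lerDl.
  have -> : u = 1 - s by rewrite -su1 addrAC subrr add0r.
  exact: cf (Itv01 s0 s1) x y (mem_set Dx) (mem_set Dy).
by apply: cf => //; [rewrite subr_ge0|rewrite subrKC].
Qed.

Lemma convex_setP {R : realType} {E : lmodType R} (D : set E) :
  convex_set D ->
  forall x y s u, D x -> D y -> 0 <= s -> 0 <= u -> s + u = 1 ->
    D (s *: x + u *: y).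
Proof.
move=> cD x y s u Dx Dy s0 u0 su1.
have s1 : s <= 1 by rewrite -su1 lerDl.
have -> : u = 1 - s by rewrite -su1 addrAC subrr add0r.
exact/set_mem/(cD x y (Itv01 s0 s1) (mem_set Dx) (mem_set Dy)).
Qed.

Lemma concave_box_bounded_below {R : realType} {m : nat} (f : 'rV[R]_m -> R)
    (s : seq 'I_m) (x : 'rV[R]_m) : concave_function setT f ->
  exists L, forall v : 'I_m -> R, (forall j, `|v j| <= 1) ->
    L <= f (x + \sum_(j <- s) v j *: delta_mx 0 j).
Proof.
move=> /concave_functionP cf; elim: s x => [|k s IHs] x.
  by exists (f x) => v _; rewrite big_nil addr0.
have [L1 HL1] := IHs (x + delta_mx 0 k).
have [L2 HL2] := IHs (x - delta_mx 0 k).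
exists (Num.min L1 L2) => v v1; rewrite big_cons.
have /andP[vk1 vk2] : -1 <= v k <= 1 by rewrite -ler_norml.
set w := \sum_(j <- s) _.
pose a := (1 + v k) / 2; pose b := (1 - v k) / 2.
have ab1 : a + b = 1 by rewrite /a /b; lra.
have a0 : 0 <= a by rewrite /a; lra.
have b0 : 0 <= b by rewrite /b; lra.
have -> : x + (v k *: delta_mx 0 k + w) =
    a *: (x + delta_mx 0 k + w) + b *: (x - delta_mx 0 k + w).
  by apply/rowP => j; rewrite !mxE /a /b; field.
apply: le_trans (cf _ _ _ _ I I a0 b0 ab1).
have {HL1} := HL1 v v1; have {HL2} := HL2 v v1; rewrite -/w => H2 H1.
set m0 := Num.min _ _.
have mL1 : m0 <= L1 by rewrite /m0 ge_min lexx.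
have mL2 : m0 <= L2 by rewrite /m0 ge_min lexx orbT.
rewrite -[m0]mul1r -ab1 mulrDl; apply: lerD.
  by rewrite ler_wpM2l// (le_trans mL1).
by rewrite ler_wpM2l// (le_trans mL2).
Qed.

Lemma concave_ball_bounded_below {R : realType} {m : nat} (f : 'rV[R]_m -> R)
    (x : 'rV[R]_m) : concave_function setT f ->
  exists L, forall v, `|v| <= 1 -> L <= f (x + v).
Proof.
move=> cf.
have [L HL] := @concave_box_bounded_below R m f (index_enum 'I_m) x cf.
exists L => v v1; rewrite (row_sum_delta v); apply: HL => j.
apply: le_trans v1; rewrite [leRHS]/Num.norm /= mx_normrE.
by apply/bigmax_geP; right => /=; exists (0, j).
Qed.

(* With [`|u| = 1] and [0 < t <= 1], the point [x + t *: u] lies on the segment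
   from [x] to [x + u], and [x] on the one from [x + t *: u] to [x - u];
   concavity and the lower bound [L] on the unit ball then give a Lipschitz
   estimate at [x]. *)
Lemma concave_continuous {R : realType} {m : nat} (f : 'rV[R]_m -> R) :
  concave_function setT f -> continuous f.
Proof.
move=> cf x; have [L HL] := concave_ball_bounded_below f x cf.
move/concave_functionP : cf => cf.
have lip w : `|w| <= 1 -> `|f (x + w) - f x| <= `|w| * (f x - L).
  move=> w1; have [->|w0] := eqVneq w 0.
    by rewrite addr0 subrr !normr0 mul0r.
  set t := `|w|; have t0 : 0 < t by rewrite normr_gt0.
  pose u := t^-1 *: w.
  have u1 : `|u| = 1.
    by rewrite normrZ normfV ger0_norm ?(ltW t0)// mulVf ?gt_eqF.
  have wE : w = t *: u by rewrite scalerA divff ?scale1r ?gt_eqF.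
  have Lu : L <= f (x + u) by apply: HL; rewrite u1.
  have LNu : L <= f (x - u) by apply: HL; rewrite normrN u1.
  have lo : (1 - t) * f x + t * f (x + u) <= f (x + w).
    have -> : x + w = (1 - t) *: x + t *: (x + u).
      by rewrite scalerDr addrA -scalerDl subrK scale1r -wE.
    by apply: cf => //; rewrite ?subr_ge0 ?(ltW t0)// subrK.
  have up : (1 + t)^-1 * f (x + w) + t / (1 + t) * f (x - u) <= f x.
    rewrite [X in _ <= f X](_ : x =
        (1 + t)^-1 *: (x + w) + (t / (1 + t)) *: (x - u)).
      apply: cf => //; first by rewrite invr_ge0; lra.
        by rewrite divr_ge0; lra.
      by field; lra.
    by rewrite wE; apply/rowP => j; rewrite !mxE; field; lra.
  have {}up : f (x + w) + t * f (x - u) <= (1 + t) * f x.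
    have : (1 + t) * ((1 + t)^-1 * f (x + w) + t / (1 + t) * f (x - u)) <=
      (1 + t) * f x by rewrite ler_wpM2l//; lra.
    apply: le_trans; rewrite le_eqVlt; apply/orP; left; apply/eqP.
    by field; lra.
  rewrite ler_norml; apply/andP; split; nra.
rewrite /continuous_at; apply/(@cvgrPdist_le _ _ _ (nbhs x)) => e e0.
pose D := 1 + `|f x - L|.
have D0 : 0 < D by rewrite /D; have := normr_ge0 (f x - L); lra.
have d0 : 0 < Num.min 1 (e / D) by rewrite lt_min ltr01 divr_gt0.
have /cvgrPdist_le /(_ _ d0) : y @[y --> x] --> x by exact: cvg_id.
apply: filterS => y; rewrite le_min => /andP[xy1 xye].
rewrite distrC -(subrKC x y); apply: le_trans (lip _ _) _.
  by rewrite distrC.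
rewrite distrC; move: xye; rewrite ler_pdivlMr// => /(le_trans _); apply.
by rewrite ler_wpM2l// (le_trans (ler_norm _))// /D lerDr.
Qed.

Lemma is_norm_ge0 {R : realType} {m : nat} (nrm : 'rV[R]_m -> R) v :
  is_norm nrm -> 0 <= nrm v.
Proof.
move=> hn; have := is_normD hn v (- v).
rewrite subrr -scaleN1r (is_normZ hn) normrN1 mul1r.
by rewrite -(scale0r v) (is_normZ hn) normr0 mul0r; lra.
Qed.

Lemma is_norm_equiv {R : realType} {m : nat} (nrm : 'rV[R]_m -> R) :
  is_norm nrm -> exists2 k, 0 < k & forall v, k * `|v| <= nrm v.
Proof.
move=> hn.
have cn : continuous (fun v => - nrm v).
  apply: concave_continuous; apply/concave_functionP => x y s u _ _ s0 u0 _.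
  rewrite !mulrN -opprD lerN2 (le_trans (is_normD hn _ _))//.
  by rewrite !(is_normZ hn) !ger0_norm.
pose S := [set v : 'rV[R]_m | `|v| = 1].
have SZ v : v != 0 -> S (`|v|^-1 *: v).
  by move=> v0; rewrite /S/= normrZ normfV normr_id mulVf// normr_eq0.
have [S0|/set0P S0] := eqVneq S set0.
  exists 1 => // v; have [->|/SZ] := eqVneq v 0; last by rewrite S0.
  by rewrite normr0 mulr0 is_norm_ge0.
have cS : compact S.
  apply: bounded_closed_compact.
    by exists 1; split => // M M1 v /= ->; exact: ltW.
  apply: (@closed_comp _ _ (@Num.norm R 'rV[R]_m) [set 1]) => [v _|].
    exact: norm_continuous.
  exact: closed_eq.
have [v0 /set_mem Sv0 v0min] := compact_EVT_max S0 cS (continuous_subspaceT cn).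
have nv0 : v0 != 0.
  by apply: contra_eq_neq Sv0 => ->; rewrite normr0 eq_sym oner_neq0.
exists (nrm v0) => [|v].
  rewrite lt_neqAle is_norm_ge0// andbT eq_sym.
  by apply: contra_neq nv0; exact: is_norm0_eq0.
have [->|nv] := eqVneq v 0; first by rewrite normr0 mulr0 is_norm_ge0.
have := v0min _ (mem_set (SZ _ nv)); rewrite lerN2 (is_normZ hn).
by rewrite normfV normr_id mulrC ler_pdivlMr ?normr_gt0.
Qed.

Lemma cost_lsc_near {R : realType} {m : nat} (Z : set 'rV[R]_m)
    (c : 'rV[R]_m -> 'rV[R]_m -> R) (zh z : 'rV[R]_m) (t : R) :
  transportation_cost Z c -> Z zh -> Z z -> t < c z zh ->
  \forall y \near z, Z y -> t < c y zh.
Proof.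
move=> hc Zzh Zz tc.
have [V] := @cost_lsc _ _ _ _ hc (z, zh) t tc.
rewrite /nbhs/= -nbhs_subspace_in// => -[[A B]/= [zA zhB] ABV] Vt.
apply: filterS zA => y Ay Zy.
suff : V (y, zh) by move/Vt; rewrite lte_fin.
by apply: ABV => //=; split => //; exact: nbhs_singleton zhB.
Qed.

Lemma cost_sublevel_compact {R : realType} {m : nat} (Z : set 'rV[R]_m)
    (c : 'rV[R]_m -> 'rV[R]_m -> R) (nrm : 'rV[R]_m -> R) (p t : R)
    (zh : 'rV[R]_m) :
  transportation_cost Z c -> closed Z -> is_norm nrm -> 1 <= p ->
  (forall z, Z z -> nrm (z - zh) `^ p <= c z zh) -> Z zh ->
  compact [set z | Z z /\ c z zh <= t].
Proof.
move=> hc clZ hn p1 growth Zzh; apply: bounded_closed_compact.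
  have [k k0 nrmk] := is_norm_equiv nrm hn.
  have nrm_le z : Z z -> c z zh <= t -> nrm (z - zh) <= 1 + `|t|.
    move=> Zz ct; have [n1|n1] := leP (nrm (z - zh)) 1.
      by rewrite (le_trans n1)// lerDl.
    rewrite -[leLHS]powRr1 ?is_norm_ge0//.
    apply: le_trans (ler_powR (ltW n1) p1) _.
    apply: le_trans (growth _ Zz) _; apply: le_trans ct _.
    by apply: le_trans (ler_norm t) _; rewrite lerDr.
  exists ((1 + `|t|) / k + `|zh|); split; first exact: num_real.
  move=> M /ltW HM z /= [Zz ct]; apply: le_trans HM.
  rewrite -[z in `|z|](subrK zh); apply: le_trans (ler_normD _ _) _.
  rewrite lerD2r ler_pdivlMr// mulrC.
  exact: le_trans (nrmk _) (nrm_le _ Zz ct).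
move=> z clz; have Zz : Z z by apply: clZ; apply: closure_subset clz => y [].
split => //; rewrite leNgt; apply/negP => tc.
have [y [[Zy cyt] /(_ Zy)]] := clz _ (cost_lsc_near _ _ _ _ _ hc Zzh Zz tc).
by rewrite ltNge cyt.
Qed.

Definition transport_pairs {R : realType} {m : nat} (Z : set 'rV[R]_m)
    (c : 'rV[R]_m -> 'rV[R]_m -> R) (zh : 'rV[R]_m) (a be : R^o * R^o) :
    set ('rV[R]_m * 'rV[R]_m) :=
  [set w | [/\ Z w.1, Z w.2, a.1 * c w.1 zh <= be.1 & a.2 * c w.2 zh <= be.2]].

Definition budgeted_pairs {R : realType} {m : nat} (Z : set 'rV[R]_m)
    (c : 'rV[R]_m -> 'rV[R]_m -> R) (zh : 'rV[R]_m) (b : R) (a : R^o * R^o) :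
    set ('rV[R]_m * 'rV[R]_m) :=
  [set w | [/\ Z w.1, Z w.2 & a.1 * c w.1 zh + a.2 * c w.2 zh <= b]].

Definition weighted_loss {R : realType} {m : nat} (l1 l2 : 'rV[R]_m -> R)
    (a : R^o * R^o) (w : 'rV[R]_m * 'rV[R]_m) : R :=
  a.1 * l1 w.1 + a.2 * l2 w.2.

Lemma is_maximum_sup {R : realType} (S : set R) (y : R) :
  is_maximum S y -> sup S = y.
Proof.
move=> [Sy uby]; apply/le_anti/andP; split.
  by apply: ge_sup => //; exists y.
by apply: ub_le_sup => //; exists y.
Qed.

Lemma Psi_valuesE {R : realType} {m : nat} (Z : set 'rV[R]_m)
    (c : 'rV[R]_m -> 'rV[R]_m -> R) (zh : 'rV[R]_m) (l1 l2 : 'rV[R]_m -> R)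
    (a be : R^o * R^o) :
  Psi_values Z c zh l1 l2 a be =
  weighted_loss l1 l2 a @` transport_pairs Z c zh a be.
Proof.
apply/seteqP; split=> [_ [v vF <-]|_ [w [Z1 Z2 c1 c2] <-]].
  by exists (zh + v.1, zh + v.2).
by exists (w.1 - zh, w.2 - zh) => /=; rewrite !subrKC.
Qed.

Section transport.
Context {R : realType} {m : nat} (Z : set 'rV[R]_m)
  (c : 'rV[R]_m -> 'rV[R]_m -> R) (zh : 'rV[R]_m) (l1 l2 : 'rV[R]_m -> R)
  (hc : transportation_cost Z c) (Zzh : Z zh) (clZ : closed Z)
  (cvxZ : convex_set Z)
  (sublevel_compact : forall t, compact [set z | Z z /\ c z zh <= t])
  (ccv1 : concave_function setT l1) (ccv2 : concave_function setT l2).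

Local Notation pairs := (transport_pairs Z c zh).
Local Notation bpairs := (budgeted_pairs Z c zh).
Local Notation obj := (weighted_loss l1 l2).

Lemma budgets_transport_pairs a b be :
  budgets b be -> pairs a be `<=` bpairs b a.
Proof. by move=> [<- _ _] w [Z1 Z2 c1 c2]; split => //; exact: lerD. Qed.

Lemma budgeted_pairsP a b w : weights a -> bpairs b a w ->
  exists2 be, budgets b be & pairs a be w.
Proof.
move=> [_ a1 a2] [Z1 Z2 cb]; have c1 := cost_ge0 hc Z1 Zzh.
have c2 := cost_ge0 hc Z2 Zzh.
exists (a.1 * c w.1 zh, b - a.1 * c w.1 zh); split => //=.
- by rewrite addrC subrK.
- by rewrite mulr_ge0// ltW.
- by rewrite subr_ge0 (le_trans _ cb)// lerDl mulr_ge0// ltW.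
- by rewrite lerBrDl.
Qed.

Lemma transport_pairs_zh a be b : budgets b be -> pairs a be (zh, zh).
Proof.
by move=> [_ be1 be2]; split => //=; rewrite (cost_refl hc Zzh) mulr0.
Qed.

Lemma transport_pairs_compact a be : weights a -> compact (pairs a be).
Proof.
move=> [_ a1 a2].
rewrite (_ : pairs a be = [set z | Z z /\ c z zh <= be.1 / a.1] `*`
                          [set z | Z z /\ c z zh <= be.2 / a.2]).
  exact: compact_setX.
apply/seteqP; split=> w /=.
  by move=> [Z1 Z2 c1 c2]; rewrite !ler_pdivlMr// (mulrC _ a.1) (mulrC _ a.2).
by rewrite !ler_pdivlMr// (mulrC _ a.1) (mulrC _ a.2) => -[[? ?] [? ?]].
Qed.

Lemma budgeted_pairs_closed a b : weights a -> closed (bpairs b a).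
Proof.
move=> [a12 a1 a2] w clw.
have Z1 : Z w.1.
  apply: (closed_comp (f := fst) (D := Z)) => //.
    by move=> ? _; exact: cvg_fst.
  by apply: closure_subset clw => y [].
have Z2 : Z w.2.
  apply: (closed_comp (f := snd) (D := Z)) => //.
    by move=> ? _; exact: cvg_snd.
  by apply: closure_subset clw => y [].
split => //; rewrite leNgt; apply/negP => bc.
pose e := (a.1 * c w.1 zh + a.2 * c w.2 zh - b) / 2.
have e0 : 0 < e by rewrite divr_gt0// subr_gt0.
have ce z : c z zh - e < c z zh by rewrite gtrBl.
have n1 := cost_lsc_near _ _ _ _ _ hc Zzh Z1 (ce w.1).
have n2 := cost_lsc_near _ _ _ _ _ hc Zzh Z2 (ce w.2).
have nw : nbhs w ([set y | Z y -> c w.1 zh - e < c y zh] `*`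
                  [set y | Z y -> c w.2 zh - e < c y zh]).
  by exists ([set y | Z y -> c w.1 zh - e < c y zh],
             [set y | Z y -> c w.2 zh - e < c y zh]).
have [y [[Zy1 Zy2 cy] [/= /(_ Zy1) c1 /(_ Zy2) c2]]] := clw _ nw.
have eE : b = a.1 * c w.1 zh + a.2 * c w.2 zh - 2 * e by rewrite /e; lra.
by nra.
Qed.

Lemma budgeted_pairs_compact a b : weights a -> compact (bpairs b a).
Proof.
move=> wa; have [_ a1 a2] := wa.
apply: (subclosed_compact _ (transport_pairs_compact a (b, b) wa)).
  exact: budgeted_pairs_closed.
move=> w /(budgeted_pairsP _ _ _ wa)[be [<- be1 be2]] [Z1 Z2 c1 c2]; split => //=.
  by rewrite (le_trans c1)// lerDl.
by rewrite (le_trans c2)// lerDr.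
Qed.

Lemma weighted_loss_max a (D : set ('rV[R]_m * 'rV[R]_m)) :
  D !=set0 -> compact D ->
  exists2 w, D w & forall w', D w' -> obj a w' <= obj a w.
Proof.
move=> D0 cD; have cobj : continuous (obj a).
  move=> w; apply: cvgD; apply: cvgZr.
    apply: (@continuous_comp _ _ _ fst l1); first exact: cvg_fst.
    exact: concave_continuous.
  apply: (@continuous_comp _ _ _ snd l2); first exact: cvg_snd.
  exact: concave_continuous.
have [w /set_mem Dw wmax] := compact_EVT_max D0 cD (continuous_subspaceT cobj).
by exists w => // w' Dw'; exact/wmax/mem_set.
Qed.

Lemma Psi_max a be b : weights a -> budgets b be ->
  is_maximum (Psi_values Z c zh l1 l2 a be) (Psi Z c zh l1 l2 a be).
Proof.
move=> wa bbe.
have [|w Dw wmax] := weighted_loss_max a _ _ (transport_pairs_compact a be wa).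
  by exists (zh, zh); exact: transport_pairs_zh bbe.
have max : is_maximum (Psi_values Z c zh l1 l2 a be) (obj a w).
  by rewrite Psi_valuesE; split; [exists w|move=> _ [w' Dw' <-]; exact: wmax].
by rewrite /Psi (is_maximum_sup _ _ max).
Qed.

Lemma Psi_attained a be b : weights a -> budgets b be ->
  exists2 w, pairs a be w & Psi Z c zh l1 l2 a be = obj a w.
Proof.
by move=> wa /(Psi_max _ _ _ wa)[]; rewrite Psi_valuesE => -[w Dw <-] _; exists w.
Qed.

Lemma le_Psi a be b w : weights a -> budgets b be -> pairs a be w ->
  obj a w <= Psi Z c zh l1 l2 a be.
Proof.
move=> wa bbe Dw; have [_] := Psi_max _ _ _ wa bbe.
by apply; rewrite Psi_valuesE; exists w.
Qed.

Lemma Phi_attained a b : 0 <= b -> weights a ->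
  is_maximum (Phi_values Z c zh l1 l2 b a) (Phi Z c zh l1 l2 b a) /\
  exists2 w, bpairs b a w & Phi Z c zh l1 l2 b a = obj a w.
Proof.
move=> b0 wa.
have [|w Dw wmax] := weighted_loss_max a _ _ (budgeted_pairs_compact a b wa).
  by exists (zh, zh); split => //=; rewrite (cost_refl hc Zzh) !mulr0 addr0.
have max : is_maximum (Phi_values Z c zh l1 l2 b a) (obj a w).
  have ub : ubound (Phi_values Z c zh l1 l2 b a) (obj a w).
    move=> _ [be bbe <-]; have [w' Dw' ->] := Psi_attained _ _ _ wa bbe.
    exact/wmax/(budgets_transport_pairs _ _ _ bbe).
  split => //; have [be bbe wbe] := budgeted_pairsP _ _ _ wa Dw.
  exists be => //; apply/le_anti/andP; split; first by apply: ub; exists be.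
  exact: le_Psi wa bbe wbe.
by rewrite /Phi (is_maximum_sup _ _ max); split => //; exists w.
Qed.

Lemma le_Phi a b w : 0 <= b -> weights a -> bpairs b a w ->
  obj a w <= Phi Z c zh l1 l2 b a.
Proof.
move=> b0 wa Dw; have [be bbe wbe] := budgeted_pairsP _ _ _ wa Dw.
apply: le_trans (le_Psi _ _ _ _ wa bbe wbe) _.
by have [[_ ub] _] := Phi_attained _ _ b0 wa; apply: ub; exists be.
Qed.

(* Perspective of a concave function: the points are averaged with weights
   proportional to [s * p] and [u * q]. *)
Lemma convex_perspective (s u p q r : R) (z z' : 'rV[R]_m) :
    0 <= s -> 0 <= u -> 0 <= p -> 0 <= q -> 0 < r -> s * p + u * q = r ->
    Z z -> Z z' ->
  exists z'', [/\ Z z'',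
    r * c z'' zh <= s * (p * c z zh) + u * (q * c z' zh) &
    forall f, concave_function setT f ->
      s * (p * f z) + u * (q * f z') <= r * f z''].
Proof.
move=> s0 u0 p0 q0 r0 rE Zz Zz'.
have sr0 : 0 <= s * p / r by rewrite divr_ge0 ?mulr_ge0// ltW.
have ur0 : 0 <= u * q / r by rewrite divr_ge0 ?mulr_ge0// ltW.
have ru : s * p / r + u * q / r = 1 by rewrite -mulrDl rE divff// gt_eqF.
have avgE (x y : R) : s * (p * x) + u * (q * y) =
    r * (s * p / r * x + u * q / r * y).
  by field; rewrite gt_eqF.
exists (s * p / r *: z + u * q / r *: z'); split.
- exact: convex_setP.
- rewrite avgE ler_wpM2l ?(ltW r0)//.
  by move/convex_functionP : (cost_convex hc Zzh); exact.
- move=> f /concave_functionP cf.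
  by rewrite avgE ler_wpM2l ?(ltW r0)//; exact: cf.
Qed.

Lemma Psi_concave a b : weights a ->
  concave_function (budgets b) (Psi Z c zh l1 l2 a).
Proof.
move=> wa; have [_ a1 a2] := wa.
apply/concave_functionP => x y s u bx bdy s0 u0 su1.
have [w [Z1 Z2 c1 c2] ->] := Psi_attained _ _ _ wa bx.
have [v [Z1' Z2' c1' c2'] ->] := Psi_attained _ _ _ wa bdy.
have bxy : budgets b (s *: x + u *: y).
  case: bx bdy => [bx bx1 bx2] [bdy by1 by2]; split => /=.
  - by rewrite addrACA -!scalerDr bx bdy -scalerDl su1 scale1r.
  - by rewrite addr_ge0 ?mulr_ge0.
  - by rewrite addr_ge0 ?mulr_ge0.
have suE (p : R) : s * p + u * p = p by rewrite -mulrDl su1 mul1r.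
have [z1 [Zz1 cz1 lz1]] := convex_perspective _ _ _ _ _ _ _ s0 u0
  (ltW a1) (ltW a1) a1 (suE _) Z1 Z1'.
have [z2 [Zz2 cz2 lz2]] := convex_perspective _ _ _ _ _ _ _ s0 u0
  (ltW a2) (ltW a2) a2 (suE _) Z2 Z2'.
apply: le_trans (le_Psi _ _ _ (z1, z2) wa bxy _).
  rewrite /weighted_loss !mulrDr addrACA.
  by apply: lerD; [exact: lz1|exact: lz2].
by split => //=; [apply: le_trans cz1 _|apply: le_trans cz2 _];
  apply: lerD; exact: ler_wpM2l.
Qed.

Lemma Phi_concave b : 0 <= b ->
  concave_function (@weights R) (Phi Z c zh l1 l2 b).
Proof.
move=> b0; apply/concave_functionP => x y s u wx wy s0 u0 su1.
have [_ [w [Z1 Z2 cb] ->]] := Phi_attained _ _ b0 wx.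
have [_ [v [Z1' Z2' cb'] ->]] := Phi_attained _ _ b0 wy.
have [x12 x1 x2] := wx; have [y12 y1 y2] := wy.
have pos (p q : R) : 0 < p -> 0 < q -> 0 < s * p + u * q.
  move=> p0 q0; have [s00|s0'] := eqVneq s 0.
    by move: su1; rewrite s00 add0r => ->; rewrite mul0r mul1r add0r.
  have {}s0' : 0 < s by rewrite lt_def s0'.
  by apply: ltr_pwDl; rewrite ?mulr_gt0// mulr_ge0// ltW.
have wxy : weights (s *: x + u *: y).
  split => /=; [|exact: pos|exact: pos].
  by rewrite addrACA -!scalerDr x12 y12 -scalerDl su1 scale1r.
have [z1 [Zz1 cz1 lz1]] := convex_perspective _ _ _ _ _ _ _ s0 u0
  (ltW x1) (ltW y1) (pos _ _ x1 y1) erefl Z1 Z1'.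
have [z2 [Zz2 cz2 lz2]] := convex_perspective _ _ _ _ _ _ _ s0 u0
  (ltW x2) (ltW y2) (pos _ _ x2 y2) erefl Z2 Z2'.
apply: le_trans (le_Phi _ _ (z1, z2) b0 wxy _).
  rewrite /weighted_loss !mulrDr addrACA.
  by apply: lerD; [exact: lz1|exact: lz2].
split => //=; apply: le_trans (lerD cz1 cz2) _.
rewrite addrACA -!mulrDr -[leRHS]mul1r -su1 mulrDl.
by apply: lerD; exact: ler_wpM2l.
Qed.

End transport.

Theorem lemma6 (R : realType) (n m N K : nat)
    (X : set 'rV[R]_n) (Z : set 'rV[R]_m)
    (c : 'rV[R]_m -> 'rV[R]_m -> R)
    (zhat : 'I_N -> 'rV[R]_m) (rho : R)
    (l : 'I_K -> 'rV[R]_n -> 'rV[R]_m -> R)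
    (hc : transportation_cost Z c)
    (hzhat : forall i, Z (zhat i))
    (hrho : 0 < rho)
    (hreg : regularity X Z c zhat rho l)
    (x : 'rV[R]_n) (hx : X x)
    (i : 'I_N) (k1 k2 : 'I_K) (hk : (k1 < k2)%N)
    (b : R) (hb : 0 <= b) :
  let psi := Psi Z c (zhat i) (l k1 x) (l k2 x) in
  let phi := Phi Z c (zhat i) (l k1 x) (l k2 x) b in
  [/\ forall a be, weights a -> budgets b be ->
        is_maximum (Psi_values Z c (zhat i) (l k1 x) (l k2 x) a be) (psi a be),
      forall a, weights a -> concave_function (budgets b) (psi a),
      forall a, weights a ->
        is_maximum (Phi_values Z c (zhat i) (l k1 x) (l k2 x) b a) (phi a) &
      concave_function (@weights R) phi].
Proof.
have Zi := hzhat i; have clZ := reg_Z_closed hreg.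
have cvxZ := reg_Z_convex hreg; have ccv k := reg_loss_concave hreg k x.
have [nrm [p [hn p1 growth _]]] := reg_growth hreg.
have sub t : compact [set z | Z z /\ c z (zhat i) <= t].
  by apply: (cost_sublevel_compact Z c nrm p) => // z Zz; exact: growth.
split.
- by move=> a be wa bbe; apply: Psi_max wa bbe.
- by move=> a wa; apply: Psi_concave.
- move=> a wa.
  by have [] := Phi_attained _ _ _ _ _ hc Zi clZ sub (ccv k1) (ccv k2) _ _ hb wa.
- exact: Phi_concave.
Qed.
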